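(* Let $n\ge2$, $R>0$, $\varepsilon>0$. Suppose $r^{n-1}f\in L^1((0,R))$, $f\ge0$ a.e. in $(0,R)$ and $f\not\equiv0$. Then there is a nonnegative classical solution to the problem $-\varepsilon r^{n-1}\Big(\frac{1}{r^{n-1}}w_r\Big)_r+\frac{1}{n r^{n(n-1)}}w^n=L_f$ in $(0,R)$, $w(0)=w_r(0)=0$, $w_r(R)=\varepsilon R^{n-1}$.
   Context: $L_f(s):=\int_0^s t^{n-1}f(t)\,dt$. Subscripts $r$ denote derivatives in $r$. A classical solution is a twice differentiable function satisfying the equation in $(0,R)$ and the boundary conditions pointwise. *)

(* Defs.v *)
From HB Require Import structures.
From mathcomp Require Import all_boot all_order all_algebra.
From mathcomp Require Import all_classical all_reals all_analysis.
Set Implicit Arguments. Unset Strict Implicit. Unset Printing Implicit Defensive.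
Import Order.TTheory GRing.Theory Num.Theory.
Import numFieldNormedType.Exports.
Local Open Scope classical_set_scope.
Local Open Scope ring_scope.

Definition Lf {R : realType} (n : nat) (f : R -> R) (s : R) : R :=
  Rintegral (@lebesgue_measure R) `[0, s] (fun t => t ^+ n.-1 * f t).

(* Main.v *)
Require Import Defs.
From HB Require Import structures.
From mathcomp Require Import all_boot all_order all_algebra.
From mathcomp Require Import all_classical all_reals all_analysis.
From mathcomp Require Import ring lra.
Import Order.TTheory GRing.Theory Num.Theory.
Import numFieldNormedType.Exports.
Local Open Scope classical_set_scope.
Local Open Scope ring_scope.
Set Implicit Arguments.
Unset Strict Implicit.
Unset Printing Implicit Defensive.

(** Shoot from [r = R] towards the singular end [r = 0]. In the variable [x] with
    [r = R e^(-2x)], the unknowns [y = w] and [z = - w_r / r^(n-1)] solve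
      [y' = 2 r^n z],  [z' = 2 r^2 / (eps r^n) (y^n / (n r^(n(n-1))) - L_f(r))],
      [y(0) = c],  [z(0) = - eps]
    for [x >= 0], where all coefficients are continuous. After clamping [y] to
    [[0, M]] in the nonlinearity, this is a global Lipschitz system whose solution
    depends continuously on [c]. Since the nonlinearity is nonnegative, and zero for
    [y <= 0], the zero function and [Y = M (r/R)^(3/2)] are a sub- and a
    supersolution for [M] large: once [y] drops below 0, or exceeds [Y], it remains
    so for all larger [x]. The initial values [c] in [[0, M]] for which the first,
    respectively the second, happens form disjoint relatively open sets containing
    0, respectively [M], so some [c] lies in neither. Then [0 <= w <= Y], the clamp
    is inactive, and the exponent [3/2 > 1] gives [w(0) = w_r(0) = 0]. *)

(** * Calculus preliminaries: monotonicity, primitives, geometric convergence *)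

Lemma le_of_derive_ge0 {R : realType} (f df : R -> R) (a b : R) : a <= b ->
  (forall x, a <= x <= b -> is_derive x 1 f (df x)) ->
  (forall x, a < x < b -> 0 <= df x) -> f a <= f b.
Proof.
move=> ab fdf df0.
apply: (@ger0_derive1_le_cc _ f a b) => //; last 2 first.
- by rewrite in_itv/= lexx.
- by rewrite in_itv/= ab lexx.
- move=> x; rewrite in_itv/= => /andP[/ltW ax /ltW xb].
  by have [] : is_derive x 1 f (df x) by apply: fdf; rewrite ax.
- move=> x; rewrite in_itv/= => /andP[ax xb].
  have [_] : is_derive x 1 f (df x) by apply: fdf; rewrite !ltW.
  by rewrite derive1E => ->; apply: df0; rewrite ax.
- apply: derivable_within_continuous => x; rewrite in_itv/= => axb.
  by have [] := fdf x axb.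
Qed.

Lemma is_derive_continuous {R : realType} (f : R -> R) (x d : R) :
  is_derive x 1 f d -> {for x, continuous f}.
Proof. by case=> df _; apply: differentiable_continuous; apply/derivable1_diffP. Qed.

(* The base point -1 makes this two-sided differentiable at 0. *)
Definition primitive {R : realType} (h : R -> R) (x : R) : R :=
  Rintegral (@lebesgue_measure R) `[-1, x] h -
  Rintegral (@lebesgue_measure R) `[-1, 0] h.

Lemma primitive0 {R : realType} (h : R -> R) : primitive h 0 = 0.
Proof. exact: subrr. Qed.

Lemma is_derive_primitive {R : realType} (h : R -> R) (x : R) :
  continuous h -> -1 < x -> is_derive x 1 (primitive h) (h x).
Proof.
move=> ch x1.
have hi : (@lebesgue_measure R).-integrable `[-1, x + 1] (EFin \o h).
  apply: continuous_compact_integrable; first exact: segment_compact.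
  exact: continuous_subspaceT.
have [] := @continuous_FTC1_closed R h (-1) x (x + 1) _ hi x1 (ch x).
  by rewrite ltrDl.
move=> dF eF.
have : is_derive x 1 (fun y => Rintegral (@lebesgue_measure R) `[-1, y] h) (h x).
  by apply: DeriveDef; [exact: dF|rewrite -derive1E; exact: eF].
move=> dF'; rewrite -[h x]subr0; exact: is_deriveB.
Qed.

(** Adding the difference of primitives to [D / l * expR (l * t)], or subtracting it, gives a
    function that starts nonnegative and has nonnegative derivative. Each integration thus gains a
    factor [1 / l] against the exponential weight. *)
Lemma primitive_sub_le {R : realType} (h1 h2 : R -> R) (X D l : R) :
  continuous h1 -> continuous h2 -> 0 < l ->
  (forall t : R, 0 <= t <= X -> `|h1 t - h2 t| <= D * expR (l * t)) ->
  forall x : R, 0 <= x <= X ->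
  `|primitive h1 x - primitive h2 x| <= D / l * expR (l * x).
Proof.
move=> c1 c2 l0 hD x /andP[x0 xX].
have D0 : 0 <= D.
  have := hD 0; rewrite lexx (le_trans x0 xX) mulr0 expR0 mulr1.
  by move=> /(_ isT); apply: le_trans.
have dE (t : R) : is_derive t (1:R) (fun t : R => D / l * expR (l * t)) (D * expR (l * t)).
  have := @is_derive1_comp R expR (fun t : R => l * t) t _ _ (is_derive_expR _) _.
  move=> /(_ (l * 1)) de.
  have /de{}de : is_derive t 1 (fun t : R => l * t) (l * 1).
    have := @is_deriveZ _ _ _ id l t 1 1 _; exact.
  have := @is_deriveZ _ _ _ _ (D / l) t 1 _ de.
  rewrite /GRing.scale/= mulr1 => h; apply: is_derive_eq.
  by field; rewrite gt_eqF.
have dP (h : R -> R) (t : R) : continuous h -> 0 <= t <= x ->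
    is_derive t 1 (primitive h) (h t).
  by move=> ch /andP[t0 _]; apply: is_derive_primitive => //; lra.
have P0 : primitive h1 0 - primitive h2 0 = 0 by rewrite !primitive0 subrr.
have Dl : 0 <= D / l * expR (l * 0).
  by rewrite mulr0 expR0 mulr1 divr_ge0// ltW.
rewrite ler_norml; apply/andP; split.
- have := @le_of_derive_ge0 R
    (fun t : R => D / l * expR (l * t) + (primitive h1 t - primitive h2 t))
    (fun t : R => D * expR (l * t) + (h1 t - h2 t)) 0 x x0.
  rewrite P0 addr0 => H.
  suff : 0 <= D / l * expR (l * x) + (primitive h1 x - primitive h2 x) by lra.
  apply: (le_trans Dl); apply: H => t tx.
    by apply: is_deriveD => //; apply: is_deriveB; apply: dP.
  have : 0 <= t <= X by lra.
  by move=> /hD; rewrite ler_norml; lra.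
- have := @le_of_derive_ge0 R
    (fun t : R => D / l * expR (l * t) - (primitive h1 t - primitive h2 t))
    (fun t : R => D * expR (l * t) - (h1 t - h2 t)) 0 x x0.
  rewrite P0 subr0 => H.
  suff : 0 <= D / l * expR (l * x) - (primitive h1 x - primitive h2 x) by lra.
  apply: (le_trans Dl); apply: H => t tx.
    by apply: is_deriveB => //; apply: is_deriveB; apply: dP.
  have : 0 <= t <= X by lra.
  by move=> /hD; rewrite ler_norml; lra.
Qed.

(** Freezing the argument at 0 keeps it to the right of the base point -1, so continuity holds on
    the whole line. *)
Lemma continuous_primitive_max {R : realType} (h : R -> R) :
  continuous h -> continuous (fun x : R => primitive h (Num.max x 0)).
Proof.
move=> ch x; apply: (@continuous_comp _ _ _ (fun x : R => Num.max x 0)).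
  apply: (@continuous_max R R id (cst 0)); first exact: cvg_id.
  exact: cvg_cst.
have x1 : -1 < Num.max x 0 by rewrite lt_max ltrN10 orbT.
exact: is_derive_continuous (is_derive_primitive ch x1).
Qed.

Lemma exists_lt_half_pow {R : realType} (C e : R) : 0 < e ->
  exists k, C / 2 ^+ k < e.
Proof.
move=> e0; set k := Num.bound (`|C| / e); exists k.
have kC : `|C| / e < k%:R by apply: archi_boundP; rewrite divr_ge0// ltW.
rewrite ltr_pdivrMr ?exprn_gt0// -ltr_pdivrMl// mulrC.
apply: (@le_lt_trans _ _ (`|C| / e)).
  by rewrite ler_wpM2r ?invr_ge0 ?ler_norm// ltW.
apply: (lt_trans kC); rewrite -natrX ltr_nat; exact: ltn_expl.
Qed.

Lemma le0_of_le_half_pow {R : realType} (v C : R) :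
  (forall k, v <= C / 2 ^+ k) -> v <= 0.
Proof.
move=> vC; rewrite leNgt; apply/negP => v0.
have [k] := exists_lt_half_pow C v0.
by apply/negP; rewrite -leNgt.
Qed.

(** With [e k] the geometric tail, the intervals from [u k - e k] to [u k + e k] are nested: the
    lower ends increase, the upper ends decrease. Their lengths tend to 0, and the limit lies in
    every one of them. *)
Lemma limn_half_pow {R : realType} (u : nat -> R) (D : R) :
  (forall k, `|u k.+1 - u k| <= D / 2 ^+ k) ->
  forall k, `|u k - limn u| <= 2 * D / 2 ^+ k.
Proof.
move=> uD.
have D0 : 0 <= D by have := uD 0%N; rewrite expr0 divr1; apply: le_trans.
pose e k : R := 2 * D / 2 ^+ k.
have eS k : e k.+1 = D / 2 ^+ k.
  by rewrite /e exprS; field; rewrite expf_neq0.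
have eS2 k : e k = 2 * (D / 2 ^+ k) by rewrite /e mulrA.
have e0 k : 0 <= e k by rewrite /e !mulr_ge0// invr_ge0 exprn_ge0.
have up : nondecreasing_seq (fun k => u k - e k).
  by apply/nondecreasing_seqP => k; have := uD k; rewrite eS eS2 ler_norml; lra.
have dn : nonincreasing_seq (fun k => u k + e k).
  by apply/nonincreasing_seqP => k; have := uD k; rewrite eS eS2 ler_norml; lra.
have bd j k : u j - e j <= u k + e k.
  have [jk|kj] := leqP j k.
    by have := up _ _ jk; have := e0 k; lra.
  by have := dn _ _ (ltnW kj); have := e0 j; lra.
have c1 : cvgn (fun k => u k - e k).
  apply: nondecreasing_is_cvgn => //; exists (u 0%N + e 0%N).
  by move=> _ [k _ <-].
have c2 : cvgn e.
  have : (fun k => (2 * D) * 2^-1 ^+ k) @ \oo --> (2 * D) * 0.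
    apply: cvgM; first exact: cvg_cst.
    by apply: cvg_expr; rewrite ger0_norm; lra.
  rewrite (_ : (fun k => _) = e); first by move=> /cvgP.
  by apply/funext => k; rewrite /e exprVn.
have c3 : cvgn u.
  have -> : u = (fun k => u k - e k) + e by apply/funext => k; rewrite fctE subrK.
  exact: is_cvgD.
have e00 : limn e = 0.
  apply/cvg_lim => //.
  have : (fun k => (2 * D) * 2^-1 ^+ k) @ \oo --> (2 * D) * 0.
    apply: cvgM; first exact: cvg_cst.
    by apply: cvg_expr; rewrite ger0_norm; lra.
  rewrite mulr0 (_ : (fun k => _) = e)//.
  by apply/funext => k; rewrite /e exprVn.
move=> k; rewrite ler_norml; apply/andP; split.
- suff : limn u <= u k + e k by rewrite /e; lra.
  have -> : limn u = limn (fun k => u k - e k) by rewrite limB// e00 subr0.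
  apply: limr_le => //; apply: nearW => j; exact: bd.
- suff : u k - e k <= limn u by rewrite /e; lra.
  have -> : limn u = limn (fun k => u k + e k) by rewrite limD// e00 addr0.
  apply: limr_ge; first exact: is_cvgD.
  by apply: nearW => j; exact: bd.
Qed.

Lemma continuous_of_approx {R : realType} (f : nat -> R -> R) (g : R -> R) :
  (forall k, continuous (f k)) ->
  (forall x e : R, 0 < e ->
    exists k, \forall t \near x, `|f k t - g t| <= e) ->
  continuous g.
Proof.
move=> cf fg x; apply/cvgrPdist_le => /= e e0.
have e3 : 0 < e / 3 by rewrite divr_gt0.
have [k nk] := fg x _ e3.
have := cf k x; move=> /cvgrPdist_le /(_ _ e3) fk.
have kx := nbhs_singleton nk.
near=> t.
have : `|f k t - g t| <= e / 3 by near: t.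
have : `|f k x - f k t| <= e / 3 by near: t.
move: kx; rewrite !ler_norml; lra.
Unshelve. all: by end_near. Qed.

(** * Picard iteration on the half-line *)

(** Integral form of the system [w' = a v], [v' = q(x, w)], [w(0) = c], [v(0) = b], with [v]
    eliminated. The maxima with 0 extend it constantly to the left, so iterates are continuous on
    the whole line. *)
Definition picard_op {R : realType} (a : R -> R) (q : R -> R -> R) (b c : R)
    (w : R -> R) (x : R) : R :=
  c + primitive (fun t => a t *
    (b + primitive (fun s => q s (w s)) (Num.max t 0))) (Num.max x 0).

Definition picard {R : realType} (a : R -> R) (q : R -> R -> R) (b c : R)
    (k : nat) : R -> R :=
  iter k (picard_op a q b c) (fun=> c).

Definition picard_lim {R : realType} (a : R -> R) (q : R -> R -> R) (b c : R)
    (x : R) : R :=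
  limn (fun k => picard a q b c k x).

Definition continuous_lipschitz {R : realType} (q : R -> R -> R) : Prop :=
  (forall w : R -> R, continuous w -> continuous (fun t => q t (w t))) /\
  (forall X : R, exists2 K : R, 0 <= K & forall t : R, 0 <= t <= X ->
    forall u v, `|q t u - q t v| <= K * `|u - v|).

Lemma continuous_add_cst {R : realType} (b : R) (f : R -> R) :
  continuous f -> continuous (fun t => b + f t).
Proof. by move=> cf x; apply: cvgD; [exact: cvg_cst|exact: cf]. Qed.

Lemma continuous_mul {R : realType} (f g : R -> R) :
  continuous f -> continuous g -> continuous (fun t => f t * g t).
Proof. by move=> cf cg x; apply: cvgM; [exact: cf|exact: cg]. Qed.

Lemma continuous_inner {R : realType} (q : R -> R -> R) (b : R) (w : R -> R) :
  continuous_lipschitz q -> continuous w ->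
  continuous (fun t : R => b + primitive (fun s => q s (w s)) (Num.max t 0)).
Proof.
move=> [cq _] cw.
by apply: continuous_add_cst; apply: continuous_primitive_max; exact: cq.
Qed.

Lemma continuous_picard_op {R : realType} (a : R -> R) (q : R -> R -> R)
    (b c : R) (w : R -> R) :
  continuous a -> continuous_lipschitz q -> continuous w ->
  continuous (picard_op a q b c w).
Proof.
move=> ca qcl cw; apply: continuous_add_cst; apply: continuous_primitive_max.
by apply: continuous_mul => //; exact: continuous_inner.
Qed.

Lemma continuous_picard {R : realType} (a : R -> R) (q : R -> R -> R)
    (b c : R) k :
  continuous a -> continuous_lipschitz q -> continuous (picard a q b c k).
Proof.
move=> ca qcl; elim: k => [|k IH]; first by move=> x; exact: cvg_cst.
exact: continuous_picard_op.
Qed.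

Lemma continuous_bounded {R : realType} (f : R -> R) (X : R) :
  continuous f -> exists2 A, 0 <= A & forall t : R, 0 <= t <= X -> `|f t| <= A.
Proof.
move=> cf; have [X0|X0] := leP 0 X; last first.
  by exists 0 => // t; lra.
have cn : {within `[0, X], continuous (fun t => `|f t|)}.
  apply: continuous_subspaceT => x.
  by apply: (@continuous_comp _ _ _ f); [exact: cf|exact: norm_continuous].
have [m _ fm] := EVT_max X0 cn.
exists (`|f m|) => // t tX; apply: fm; by rewrite in_itv.
Qed.

(* Bielecki's weight [expR (l * x)] makes the contraction work on all of [0, X]. *)
Lemma picard_contraction {R : realType} (a : R -> R) (q : R -> R -> R)
    (b : R) (X : R) :
  continuous a -> continuous_lipschitz q ->
  exists2 l : R, 0 < l & forall (c1 c2 D : R) (w1 w2 : R -> R),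
    continuous w1 -> continuous w2 ->
    (forall t : R, 0 <= t <= X -> `|w1 t - w2 t| <= D * expR (l * t)) ->
    forall x : R, 0 <= x <= X ->
    `|picard_op a q b c1 w1 x - picard_op a q b c2 w2 x| <=
    `|c1 - c2| + D / 2 * expR (l * x).
Proof.
move=> ca qcl; have [cq lq] := qcl.
have [K K0 qK] := lq X; have [A A0 aA] := continuous_bounded X ca.
have AK0 : 0 <= A * K by rewrite mulr_ge0.
(* Two integrations cost the factor [A * K / l ^+ 2]. Since [l >= 1] and [l >= 2 * (A * K)], this is
   at most 1/2. *)
exists (1 + 2 * (A * K)); first lra.
set l := 1 + _; move=> c1 c2 D w1 w2 cw1 cw2 wD x /andP[x0 xX].
have l0 : 0 < l by rewrite /l; lra.
have D0 : 0 <= D.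
  have := wD 0; rewrite lexx (le_trans x0 xX) mulr0 expR0 mulr1.
  by move=> /(_ isT); apply: le_trans.
rewrite /picard_op (max_idPl x0).
set h1 := (fun t : R => a t * _).
set h2 := (fun t : R => a t * (b + primitive (fun s => q s (w2 s)) _)).
have ch1 : continuous h1 by apply: continuous_mul => //; exact: continuous_inner.
have ch2 : continuous h2 by apply: continuous_mul => //; exact: continuous_inner.
have inner (t : R) : 0 <= t <= X -> `|h1 t - h2 t| <= (A * (K * D / l)) * expR (l * t).
  move=> /[dup] tX /andP[t0 _]; rewrite /h1 /h2 (max_idPl t0) -mulrBr normrM -mulrA.
  apply: ler_pM => //; first exact: aA.
  have -> (u v : R) : b + u - (b + v) = u - v by ring.
  apply: (@primitive_sub_le _ _ _ X) => //; [exact: cq|exact: cq|].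
  move=> s sX; apply: le_trans (qK s sX _ _) _.
  by rewrite -mulrA ler_wpM2l// wD.
have main : `|primitive h1 x - primitive h2 x| <=
    A * (K * D / l) / l * expR (l * x).
  by apply: (@primitive_sub_le _ _ _ X) => //; rewrite x0.
have small : A * (K * D / l) / l <= D / 2.
  rewrite ler_pdivrMr// (_ : A * (K * D / l) = (A * K * D) / l); last by ring.
  rewrite ler_pdivrMr//.
  have h : 2 * (A * K) <= l * l by rewrite /l; nra.
  by have := ler_wpM2l D0 h; lra.
rewrite opprD addrACA.
apply: le_trans (ler_normD _ _) _; rewrite lerD2l.
by apply: le_trans main _; rewrite ler_wpM2r// expR_ge0.
Qed.

Lemma picard_max {R : realType} (a : R -> R) (q : R -> R -> R) (b c : R) k (x : R) :
  picard a q b c k (Num.max x 0) = picard a q b c k x.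
Proof.
case: k => [//|k]; rewrite /picard/= /picard_op.
by rewrite (max_idPl (_ : 0 <= Num.max x 0))// le_max lexx orbT.
Qed.

(** For equal initial values the contraction halves the weighted distance between consecutive
    iterates. The first distance is bounded on [0, X], and summing the geometric tail bounds the
    distance to the limit. *)
Lemma picard_approx {R : realType} (a : R -> R) (q : R -> R -> R)
    (b c X l : R) : 0 < l ->
  (forall (c1 c2 D : R) (w1 w2 : R -> R),
    continuous w1 -> continuous w2 ->
    (forall t : R, 0 <= t <= X -> `|w1 t - w2 t| <= D * expR (l * t)) ->
    forall x : R, 0 <= x <= X ->
    `|picard_op a q b c1 w1 x - picard_op a q b c2 w2 x| <=
    `|c1 - c2| + D / 2 * expR (l * x)) ->
  continuous a -> continuous_lipschitz q ->
  exists2 D : R, 0 <= D & forall k (x : R), 0 <= x <= X ->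
    `|picard a q b c k x - picard_lim a q b c x| <= D / 2 ^+ k * expR (l * x).
Proof.
move=> l0 ctr ca qcl.
have cp k := @continuous_picard R a q b c k ca qcl.
have cd : continuous (fun x => picard a q b c 1%N x + - 1 * picard a q b c 0%N x).
  move=> x; apply: cvgD; first exact: cp.
  by apply: cvgM; [exact: cvg_cst|exact: cp].
have [D D0 dD] := continuous_bounded X cd.
have e1 (x : R) : 0 <= x <= X -> 1 <= expR (l * x).
  by move=> /andP[x0 _]; rewrite -expR0 ler_expR mulr_ge0// ltW.
have step k (x : R) : 0 <= x <= X ->
    `|picard a q b c k.+1 x - picard a q b c k x| <= D / 2 ^+ k * expR (l * x).
  elim: k x => [|k IH] x xX.
    rewrite expr0 divr1; have := dD x xX; rewrite mulN1r => h.
    by apply: le_trans h _; rewrite ler_peMr// e1.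
  have := ctr c c _ _ _ (cp k.+1) (cp k) IH x xX.
  rewrite (subrr c) normr0 add0r => /le_trans; apply.
  rewrite ler_wpM2r ?expR_ge0// exprS.
  by rewrite le_eqVlt; apply/orP; left; apply/eqP; field; rewrite expf_neq0.
exists (2 * D); first by rewrite mulr_ge0.
move=> k x xX.
have := @limn_half_pow R (fun k => picard a q b c k x) (D * expR (l * x)).
have H (j : nat) : `|picard a q b c j.+1 x - picard a q b c j x| <=
    D * expR (l * x) / 2 ^+ j by rewrite mulrAC; exact: step.
by move=> /(_ H k); rewrite mulrA mulrAC.
Qed.

Lemma continuous_picard_lim {R : realType} (a : R -> R) (q : R -> R -> R)
    (b c : R) : continuous a -> continuous_lipschitz q ->
  continuous (picard_lim a q b c).
Proof.
move=> ca qcl; apply: (@continuous_of_approx R (picard a q b c)).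
  by move=> k; exact: continuous_picard.
move=> x e e0; pose X := `|x| + 1.
have xX : x < X by rewrite /X; have := ler_norm x; lra.
have [l l0 ctr] := picard_contraction b X ca qcl.
have [D D0 pD] := picard_approx c l0 ctr ca qcl.
have [k kD] := exists_lt_half_pow (D * expR (l * X)) e0.
exists k; near=> t.
have tX : t <= X by near: t; exact: (lt_le_nbhsl xX).
have mt : picard_lim a q b c t = picard_lim a q b c (Num.max t 0).
  rewrite /picard_lim.
  suff -> : (picard a q b c)^~ (Num.max t 0) = (picard a q b c)^~ t by [].
  by apply/funext => j; rewrite picard_max.
have m0 : 0 <= Num.max t 0 <= X.
  by rewrite le_max lexx orbT ge_max tX /X addr_ge0.
rewrite mt -picard_max.
apply: le_trans (pD k _ m0) _; apply: le_trans (ltW kD).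
rewrite mulrAC ler_wpM2r ?invr_ge0 ?exprn_ge0// ler_wpM2l// ler_expR ler_wpM2l//.
  exact: ltW.
by case/andP: m0.
Unshelve. all: by end_near. Qed.

(** The operator maps the [k]-th iterate to the next one, which is close of order [2^-k] both to the
    limit and, by contraction, to the image of the limit. *)
Lemma picard_lim_fixed {R : realType} (a : R -> R) (q : R -> R -> R)
    (b c : R) (x : R) : continuous a -> continuous_lipschitz q -> 0 <= x ->
  picard_lim a q b c x = picard_op a q b c (picard_lim a q b c) x.
Proof.
move=> ca qcl x0.
have [l l0 ctr] := picard_contraction b x ca qcl.
have [D D0 pD] := picard_approx c l0 ctr ca qcl.
have cy := @continuous_picard_lim R a q b c ca qcl.
have cp k := @continuous_picard R a q b c k ca qcl.
have xx : 0 <= x <= x by rewrite x0 lexx.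
apply/eqP; rewrite -subr_eq0 -normr_le0.
apply: (@le0_of_le_half_pow _ _ (D * expR (l * x))) => k.
have : `|picard_op a q b c (picard a q b c k) x - picard_lim a q b c x| <=
    D / 2 ^+ k.+1 * expR (l * x) := pD k.+1 x xx.
have := ctr c c _ _ _ (cp k) cy (pD k) x xx.
rewrite (subrr c) normr0 add0r.
move: (picard_op _ _ _ _ (picard _ _ _ _ _) _) => v.
move: (picard_op _ _ _ _ _ _) (picard_lim a q b c x) => v' u h2 h1.
have -> : u - v' = (v - v') - (v - u) by ring.
apply: le_trans (ler_normB _ _) _; apply: le_trans (lerD h2 h1) _.
by rewrite exprS le_eqVlt; apply/orP; left; apply/eqP; field; rewrite expf_neq0.
Qed.

(** The bound [2 * |c1 - c2| * expR (l * x)] passes from one iterate to the next: contraction halves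
    it and adds [|c1 - c2|], which the weight, being at least 1, absorbs. *)
Lemma picard_lim_lipschitz {R : realType} (a : R -> R) (q : R -> R -> R)
    (b X : R) : continuous a -> continuous_lipschitz q -> 0 <= X ->
  exists2 C : R, 0 < C & forall c1 c2 : R,
    `|picard_lim a q b c1 X - picard_lim a q b c2 X| <= C * `|c1 - c2|.
Proof.
move=> ca qcl X0.
have [l l0 ctr] := picard_contraction b X ca qcl.
exists (2 * expR (l * X)); first by rewrite mulr_gt0// expR_gt0.
move=> c1 c2.
have XX : 0 <= X <= X by rewrite X0 lexx.
have e1 (x : R) : 0 <= x <= X -> 1 <= expR (l * x).
  by move=> /andP[x0 _]; rewrite -expR0 ler_expR mulr_ge0// ltW.
have N0 := normr_ge0 (c1 - c2).
have H k (x : R) : 0 <= x <= X ->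
    `|picard a q b c1 k x - picard a q b c2 k x| <= 2 * `|c1 - c2| * expR (l * x).
  elim: k x => [|k IH] x xX; have := e1 x xX.
    by rewrite /picard/=; nra.
  have := ctr c1 c2 _ _ _ (@continuous_picard R a q b c1 k ca qcl)
    (@continuous_picard R a q b c2 k ca qcl) IH x xX.
  by rewrite -!/(picard _ _ _ _ k.+1); nra.
have [D1 _ p1] := picard_approx c1 l0 ctr ca qcl.
have [D2 _ p2] := picard_approx c2 l0 ctr ca qcl.
rewrite -subr_le0.
apply: (@le0_of_le_half_pow _ _ ((D1 + D2) * expR (l * X))) => k.
have := p1 k X XX; have := p2 k X XX; have := H k X XX.
have -> : (D1 + D2) * expR (l * X) / 2 ^+ k =
  D1 / 2 ^+ k * expR (l * X) + D2 / 2 ^+ k * expR (l * X) by ring.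
have -> : 2 * expR (l * X) * `|c1 - c2| = 2 * `|c1 - c2| * expR (l * X) by ring.
by rewrite lerBlDr !ler_norml => /andP[h1 h2] /andP[h3 h4] /andP[h5 h6]; apply/andP; split; lra.
Qed.

Lemma second_order_flow {R : realType} (a : R -> R) (q : R -> R -> R) (b : R) :
  continuous a -> continuous_lipschitz q ->
  exists y z : R -> R -> R,
  [/\ forall c, y c 0 = c /\ z c 0 = b,
      forall c x : R, 0 <= x -> is_derive x 1 (y c) (a x * z c x),
      forall c x : R, 0 <= x -> is_derive x 1 (z c) (q x (y c x)) &
      forall X : R, 0 <= X -> exists2 C : R, 0 < C & forall c1 c2 : R,
        `|y c1 X - y c2 X| <= C * `|c1 - c2| ].
Proof.
move=> ca qcl; have [cq _] := qcl.
pose u := picard_lim a q b.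
have cu c : continuous (u c) by exact: continuous_picard_lim.
pose v c (t : R) := b + primitive (fun s => q s (u c s)) (Num.max t 0).
have cv c : continuous (v c) by exact: continuous_inner.
(* Without the outer maximum the values for [x >= 0] are unchanged, but [y] and [z] become two-sided
   differentiable at 0. *)
pose y c (x : R) := c + primitive (fun t => a t * v c t) x.
pose z c (x : R) := b + primitive (fun s => q s (u c s)) x.
have yu c (x : R) : 0 <= x -> y c x = u c x.
  by move=> x0; rewrite /u picard_lim_fixed// /picard_op (max_idPl x0).
have zv c (x : R) : 0 <= x -> z c x = v c x.
  by move=> x0; rewrite /v (max_idPl x0).
have x1 (x : R) : 0 <= x -> -1 < x by lra.
exists y, z; split.
- by move=> c; rewrite /y /z !primitive0 !addr0.
- move=> c x x0; rewrite -[_ * _]add0r zv//; apply: is_deriveD.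
  apply: (@is_derive_primitive _ (fun t => a t * v c t)) (x1 _ x0).
  exact: continuous_mul.
- move=> c x x0; rewrite -[q _ _]add0r yu//; apply: is_deriveD.
  by apply: (@is_derive_primitive _ (fun s => q s (u c s))) (x1 _ x0); exact: cq.
- move=> X X0; have [C C0 h] := picard_lim_lipschitz b ca qcl X0.
  by exists C => // c1 c2; rewrite !yu//; exact: h.
Qed.

(** * Comparison and shooting *)

Lemma is_derive_pos_part_sq {R : realType} (x : R) :
  is_derive x 1 (fun t : R => Num.max t 0 ^+ 2) (2 * Num.max x 0).
Proof.
have [x0|x0|->] := ltgtP x 0.
- apply: (@near_eq_is_derive _ _ _ (cst 0)).
    near=> t; have t0 : t < 0 by near: t; exact: (lt_nbhsl x0).
    by rewrite (max_idPr (ltW t0)) expr0n.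
  rewrite mulr0; exact: is_derive_cst.
- apply: (@near_eq_is_derive _ _ _ (fun t : R => t ^+ 2)).
    near=> t; have t0 : 0 < t by near: t; exact: (lt_nbhsr x0).
    by rewrite (max_idPl (ltW t0)).
  apply: is_derive_eq (@is_deriveX _ _ id 2 x 1 1 (is_derive_id _ _)) _.
  by rewrite /GRing.scale/= mulr1 expr1.
- rewrite mulr0.
  have H : (fun h : R =>
      h^-1 *: (((fun t : R => Num.max t 0 ^+ 2) \o shift 0) (h *: (1 : R)) -
      Num.max 0 0 ^+ 2)) @ 0^' --> (0 : R).
    apply/cvgrPdist_le => /= e e0; near=> h.
    have h0 : h != 0 by near: h; exact: nbhs_dnbhs_neq.
    have he : `|h| <= e by near: h; apply: dnbhs0_le.
    rewrite maxxx expr0n subr0 addr0 /GRing.scale/= mulr1 sub0r normrN.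
    apply: le_trans he; rewrite normrM normfV ler_pdivrMl ?normr_gt0//.
    rewrite normrX -expr2 lerXn2r ?nnegrE// ger0_norm ?le_max ?lexx ?orbT//.
    by rewrite ge_max ler_norm normr_ge0.
  by apply: DeriveDef; [apply/cvg_ex; exists 0|apply/cvg_lim].
Unshelve. all: by end_near. Qed.

(* [max(u, 0)^2 * s] is nondecreasing and starts at 0, so [s >= 0] wherever
   [u > 0]; hence [max(u, 0)^2] is nondecreasing. *)
Lemma positive_propagation {R : realType} (u p s ds : R -> R) (x1 x2 : R) :
  (forall x : R, 0 <= x -> 0 < p x) ->
  (forall x : R, 0 <= x -> is_derive x 1 u (p x * s x)) ->
  (forall x : R, 0 <= x -> is_derive x 1 s (ds x)) ->
  (forall x : R, 0 <= x -> 0 < u x -> 0 <= ds x) ->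
  u 0 <= 0 -> 0 <= x1 -> x1 <= x2 -> 0 < u x1 -> 0 < u x2.
Proof.
move=> p0 du dds ds0 u0 x10 x12 ux1.
pose g x := Num.max (u x) 0 ^+ 2.
have dg (x : R) : 0 <= x -> is_derive x 1 g (2 * Num.max (u x) 0 * (p x * s x)).
  move=> x0; apply: (@is_derive1_comp _ (fun t : R => Num.max t 0 ^+ 2) u).
    exact: is_derive_pos_part_sq.
  exact: du.
have m0 x : 0 <= Num.max (u x) 0 by rewrite le_max lexx orbT.
have phi (x : R) : 0 <= x -> 0 <= g x * s x.
  move=> x0; have <- : g 0 * s 0 = 0 by rewrite /g (max_idPr u0) expr0n mul0r.
  apply: (@le_of_derive_ge0 _ (fun x : R => g x * s x)
    (fun x : R => g x * ds x + s x * (2 * Num.max (u x) 0 * (p x * s x)))) => // t.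
    move=> /andP[t0 _]; exact: (@is_deriveM _ _ g s t 1 _ _ (dg t t0) (dds t t0)).
  (* One term of the derivative is a nonnegative multiple of [s t ^+ 2]; the other, [g t * ds t],
     vanishes unless [u t > 0], and then [ds t >= 0]. *)
  move=> /andP[/ltW t0 _]; apply: addr_ge0; last first.
    have -> : s t * (2 * Num.max (u t) 0 * (p t * s t)) =
      2 * Num.max (u t) 0 * p t * (s t ^+ 2) by ring.
    apply: mulr_ge0; last exact: sqr_ge0.
    by apply: mulr_ge0; [rewrite mulr_ge0|exact/ltW/p0].
  have [ut|ut] := leP (u t) 0; first by rewrite /g (max_idPr ut) expr0n mul0r.
  by rewrite mulr_ge0 ?ds0// /g sqr_ge0.
have ms (x : R) : 0 <= x -> 0 <= Num.max (u x) 0 * s x.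
  move=> x0; have [ut|ut] := leP (u x) 0; first by rewrite mul0r.
  have := phi x x0; rewrite /g (max_idPl (ltW ut)) => h.
  by apply: mulr_ge0; [exact: ltW|rewrite -(pmulr_rge0 _ (_ : 0 < u x ^+ 2))// exprn_gt0].
have : g x1 <= g x2.
  apply: (le_of_derive_ge0 x12) => t /andP[xt _].
    by apply: dg; exact: le_trans xt.
  have t0 : 0 <= t by apply: le_trans (ltW xt).
  rewrite (_ : 2 * _ * _ = 2 * p t * (Num.max (u t) 0 * s t)); last by ring.
  by apply: mulr_ge0; [rewrite mulr_ge0// ltW// p0|exact: ms].
apply: contraTT; rewrite -leNgt -ltNge => ux2.
by rewrite /g (max_idPr ux2) expr0n (max_idPl (ltW ux1)) exprn_gt0.
Qed.

(** The supremum of the values [c] whose solution becomes negative works. If its own solution became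
    negative, so would that of a slightly larger [c]; if it exceeded [Y], so would that of some
    nearby [c] in [A], against disjointness. *)
Lemma shooting {R : realType} (y : R -> R -> R) (Y : R -> R) (M : R) :
  0 < M ->
  (forall X : R, 0 <= X -> exists2 C : R, 0 < C &
    forall c1 c2 : R, `|y c1 X - y c2 X| <= C * `|c1 - c2|) ->
  (exists2 x : R, 0 <= x & y 0 x < 0) ->
  (exists2 x : R, 0 <= x & Y x < y M x) ->
  (forall c x1 x2 : R, 0 <= c <= M -> 0 <= x1 -> 0 <= x2 ->
    y c x1 < 0 -> Y x2 < y c x2 -> False) ->
  exists2 c : R, 0 <= c <= M & forall x : R, 0 <= x -> 0 <= y c x <= Y x.
Proof.
move=> M0 lip [xa xa0 ya] [xb xb0 yb] disj.
pose A : set R := [set c | 0 <= c <= M /\ exists2 x : R, 0 <= x & y c x < 0].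
have A0 : A 0 by split; [rewrite lexx ltW|exists xa].
have ubM : ubound A M by move=> c [/andP[_ cM] _].
have hsA : has_sup A by split; [exists 0|exists M].
have cs0 : 0 <= sup A by apply: ub_le_sup => //; exists M.
have csM : sup A <= M by apply: sup_le_ub => //; exists 0.
exists (sup A); first by rewrite cs0.
move=> x x0; have [C C0 hC] := lip x x0; apply/andP; split; rewrite leNgt; apply/negP => h.
- have cltM : sup A < M.
    rewrite lt_neqAle csM andbT; apply/eqP => e; rewrite e in h.
    by apply: (disj M x xb) => //; rewrite lexx ltW.
  (* Here [C * d] is half the depth below 0, so moving [c] by at most [d] keeps [y c x] negative.
     The same halving of the gap is used above [Y]. *)
  pose d := - y (sup A) x / (2 * C).
  have d0 : 0 < d by rewrite divr_gt0 ?mulr_gt0// oppr_gt0.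
  pose c := Num.min M (sup A + d).
  have cA : sup A < c by rewrite lt_min cltM ltrDl.
  have cd : c <= sup A + d by rewrite ge_min lexx orbT.
  have : A c.
    split; first by rewrite (le_trans cs0 (ltW cA)) ge_min lexx.
    exists x => //; have := hC c (sup A); rewrite (ger0_norm (_ : 0 <= c - sup A)); last by lra.
    have : C * (c - sup A) <= C * d by rewrite ler_pM2l//; lra.
    rewrite (_ : C * d = - y (sup A) x / 2); last by rewrite /d; field; rewrite gt_eqF.
    by rewrite ler_norml; lra.
  by move=> /(ub_le_sup (ex_intro _ M ubM)); rewrite leNgt cA.
- pose d := (y (sup A) x - Y x) / (2 * C).
  have d0 : 0 < d by rewrite divr_gt0 ?mulr_gt0// subr_gt0.
  have [c [cM [x1 x10 yc]] dc] := sup_adherent d0 hsA.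
  have cle : c <= sup A by apply: ub_le_sup; [exists M|split => //; exists x1].
  apply: (disj c x1 x) => //.
  have := hC c (sup A); rewrite (ler0_norm (_ : c - sup A <= 0)); last by lra.
  have : C * - (c - sup A) <= C * d by rewrite ler_pM2l//; lra.
  rewrite (_ : C * d = (y (sup A) x - Y x) / 2); last by rewrite /d; field; rewrite gt_eqF.
  by rewrite ler_norml; lra.
Qed.

(** * The truncated nonlinearity *)

Definition clamp {R : realType} (M u : R) : R := Num.min (Num.max u 0) M.

Lemma clamp_itv {R : realType} (M u : R) : 0 <= M -> 0 <= clamp M u <= M.
Proof. by move=> M0; rewrite /clamp le_min ge_min M0 le_max !lexx !orbT. Qed.

Lemma clamp_id {R : realType} (M u : R) : 0 <= u <= M -> clamp M u = u.
Proof. by move=> /andP[u0 uM]; rewrite /clamp (max_idPl u0) (min_idPl uM). Qed.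

Lemma clamp_le0 {R : realType} (M u : R) : 0 <= M -> u <= 0 -> clamp M u = 0.
Proof. by move=> M0 u0; rewrite /clamp (max_idPr u0) (min_idPl M0). Qed.

Lemma clamp_lipschitz {R : realType} (M u v : R) :
  `|clamp M u - clamp M v| <= `|u - v|.
Proof.
rewrite /clamp.
have := ler_norm (u - v); have := ler_norm (v - u); rewrite (distrC v u) => h1 h2.
rewrite ler_norml; apply/andP.
case: (leP u 0) => ?; case: (leP v 0) => ?; case: (leP 0 M) => ?;
  case: (leP u M) => ?; case: (leP v M) => ?; split; lra.
Qed.

Lemma exprn_lipschitz {R : realType} (M : R) n : 0 <= M ->
  exists2 C : R, 0 <= C & forall x y : R, 0 <= x <= M -> 0 <= y <= M ->
    `|x ^+ n - y ^+ n| <= C * `|x - y|.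
Proof.
move=> M0; elim: n => [|n [C C0 IH]].
  by exists 0 => // x y _ _; rewrite !expr0 subrr normr0 mul0r.
exists (M * C + M ^+ n); first by rewrite addr_ge0 ?mulr_ge0 ?exprn_ge0.
move=> x y /[dup] xM /andP[x0 xM'] /[dup] yM /andP[y0 yM'].
have -> : x ^+ n.+1 - y ^+ n.+1 = x * (x ^+ n - y ^+ n) + y ^+ n * (x - y).
  by rewrite !exprS; ring.
apply: le_trans (ler_normD _ _) _; rewrite mulrDl -mulrA !normrM; apply: lerD.
  by apply: ler_pM => //; [rewrite ger0_norm|exact: IH].
by rewrite ler_wpM2r// normrX ger0_norm// lerXn2r ?nnegrE.
Qed.

Lemma continuous_clamp {R : realType} (M : R) : continuous (clamp M).
Proof.
move=> x; apply: (@continuous_min R R (fun t : R => Num.max t 0) (cst M)); last exact: cvg_cst.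
by apply: (@continuous_max R R id (cst 0)); [exact: cvg_id|exact: cvg_cst].
Qed.

Lemma continuous_lipschitz_clamp {R : realType} (k m l : R -> R) (M : R) n :
  0 <= M -> continuous k -> continuous m -> continuous l ->
  continuous_lipschitz (fun t u => k t * (clamp M u ^+ n * m t - l t)).
Proof.
move=> M0 ck cm cl; split.
- move=> w cw; apply: continuous_mul => // x; apply: cvgB; last exact: cl.
  apply: (@continuous_mul R (fun t => clamp M (w t) ^+ n) m _ cm) => {}x.
  apply: (@continuous_comp _ _ _ w (fun v => clamp M v ^+ n)); first exact: cw.
  apply: (@continuous_comp _ _ _ (clamp M) (fun v => v ^+ n)).
    exact: continuous_clamp.
  exact: exprn_continuous.
- move=> X; have [K K0 kK] := continuous_bounded X ck.
  have [N N0 mN] := continuous_bounded X cm.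
  have [C C0 hC] := exprn_lipschitz n M0.
  exists (K * (C * N)); first by rewrite !mulr_ge0.
  move=> t tX u v; rewrite -mulrBr normrM -mulrA; apply: ler_pM => //.
    exact: kK.
  have -> (p r s w : R) : p * r - s - (w * r - s) = (p - w) * r by ring.
  rewrite normrM mulrAC; apply: ler_pM => //; last exact: mN.
  apply: le_trans (hC _ _ (clamp_itv _ M0) (clamp_itv _ M0)) _.
  by rewrite ler_wpM2l// clamp_lipschitz.
Qed.

(** * The integral term and its continuous extension *)

Lemma continuous_comp_clamp {R : realType} (F : R -> R) (M : R) : 0 <= M ->
  {within `[0, M], continuous F} -> continuous (fun x => F (clamp M x)).
Proof.
move=> M0 /subspace_continuousP cF x.
have cI t : `[0, M]%classic (clamp M t) by rewrite /= in_itv/= clamp_itv.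
move=> U /(cF _ (cI x)) FU; have := @continuous_clamp R M x _ FU.
rewrite /nbhs/=; apply: (@filterS _ (nbhs x)) => t /=; apply; exact: cI.
Qed.

(** Almost everywhere on [A], [g] equals its absolute value, whose integral is nonnegative. *)
Lemma Rintegral_ae_ge0 {R : realType} (g : R -> R) (A : set R) :
  measurable A -> (@lebesgue_measure R).-integrable A (EFin \o g) ->
  {ae @lebesgue_measure R, forall x, A x -> 0 <= g x} ->
  0 <= Rintegral (@lebesgue_measure R) A g.
Proof.
move=> mA ig g0.
have mg := measurable_int (@lebesgue_measure R) ig.
rewrite /Rintegral.
have -> : (\int[@lebesgue_measure R]_(x in A) (g x)%:E =
           \int[@lebesgue_measure R]_(x in A) `|(g x)%:E|)%E.
  apply: ae_eq_integral; [exact: mA|exact: mg| |].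
    exact: (measurable_int (@lebesgue_measure R) (integrable_abse ig)).
  move: g0; apply: filterS; first exact: (ae_filter_ringOfSetsType (@lebesgue_measure R)).
  by move=> x g0 Ax /=; rewrite ger0_norm// g0.
by apply: fine_ge0; apply: integral_ge0 => x _.
Qed.

(** Integrating up to [clamp rad x] extends [Lf] constantly outside [0, rad], giving the globally
    continuous and bounded term that the flow needs. *)
Lemma Lf_extension {R : realType} (n : nat) (rad : R) (f : R -> R) : 0 < rad ->
  (@lebesgue_measure R).-integrable `]0, rad[ (fun t => (t ^+ n.-1 * f t)%:E) ->
  {ae @lebesgue_measure R, forall x, x \in `]0, rad[ -> 0 <= f x} ->
  exists L : R -> R, exists2 B : R, 0 <= B & [/\ continuous L,
    forall x, 0 <= L x <= B & forall s, 0 < s < rad -> L s = Lf n f s].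
Proof.
move=> rad0 fi f0; pose g t := t ^+ n.-1 * f t.
have igoo : (@lebesgue_measure R).-integrable `]0, rad[ (EFin \o g) by [].
have mg := measurable_int (@lebesgue_measure R) igoo.
have mgcc := measurable_realfun.emeasurable_fun_itv_cc mg.
have igcc : (@lebesgue_measure R).-integrable `[0, rad] (EFin \o g).
  apply/integrableP; split => //.
  rewrite integral_itv_bndoo; last first.
    exact: (measurable_int (@lebesgue_measure R) (integrable_abse igoo)).
  by case/integrableP: igoo.
have cL := continuous_comp_clamp (ltW rad0) (parameterized_integral_continuous (ltW rad0) igcc).
set L := fun x => _ in cL.
have [B B0 LB] := continuous_bounded rad cL.
exists L, B => //; split => //; last first.
  by move=> s /andP[s0 sr]; rewrite /L clamp_id// !ltW.
move=> x; have /andP[c0 c1] := clamp_itv x (ltW rad0).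
have Lx : L x = L (clamp rad x) by rewrite /L (clamp_id (clamp_itv _ (ltW rad0))).
apply/andP; split; last first.
  by rewrite Lx (le_trans (ler_norm _))// LB// c0.
have ig : (@lebesgue_measure R).-integrable `]0, clamp rad x[ (EFin \o g).
  apply: integrableS igoo => //; apply: subset_itvl; by rewrite bnd_simp.
rewrite /L/= /parameterized_integral.
(* The sign of [f] is known only inside the open interval; the endpoints carry no mass. *)
have <- : Rintegral (@lebesgue_measure R) `]0, clamp rad x[ g =
    Rintegral (@lebesgue_measure R) `[0, clamp rad x] g.
  have ic (b0 b1 : bool) : (@lebesgue_measure R).-integrable
      [set` Interval (BSide b0 0) (BSide b1 (clamp rad x))] (EFin \o g).
    apply: integrableS igcc => //; apply: subset_itv.
      by rewrite bnd_simp; case: (b0); rewrite bnd_simp.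
    by case: (b1); rewrite bnd_simp.
  by rewrite Rintegral_itv_bndo_bndc// Rintegral_itv_obnd_cbnd.
apply: Rintegral_ae_ge0 => //.
move: f0; apply: filterS; first exact: (ae_filter_ringOfSetsType (@lebesgue_measure R)).
move=> t f0; rewrite /= in_itv/= => /andP[t0 tx].
rewrite /g; apply: mulr_ge0; first exact/exprn_ge0/ltW.
by apply: f0; rewrite in_itv/= t0; exact: lt_le_trans c1.
Qed.

(** * The radial problem *)

(** Derivatives are written as multiples of the function itself: logarithmic derivatives add under
    products, scale under powers and change sign under inversion. This reduces [radius] and the
    barrier to algebra. *)
Lemma is_derive_proportionalM {R : realType} (f g : R -> R) (a b x : R) :
  is_derive x 1 f (a * f x) -> is_derive x 1 g (b * g x) ->
  is_derive x 1 (fun t => f t * g t) ((a + b) * (f x * g x)).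
Proof.
move=> df dg; apply: is_derive_eq (@is_deriveM _ _ f g x 1 _ _ df dg) _.
by rewrite /GRing.scale/=; ring.
Qed.

Lemma is_derive_proportionalX {R : realType} (f : R -> R) (a x : R) n :
  is_derive x 1 f (a * f x) ->
  is_derive x 1 (fun t => f t ^+ n) (n%:R * a * f x ^+ n).
Proof.
move=> df; elim: n => [|n IH].
  rewrite (_ : (fun t => _) = cst 1); last by apply/funext => t; rewrite expr0.
  by rewrite !mul0r; exact: is_derive_cst.
rewrite (_ : (fun t => _) = (fun t => f t * f t ^+ n)); last by apply/funext => t; rewrite exprS.
apply: is_derive_eq (is_derive_proportionalM df IH) _.
by rewrite exprS -natr1; ring.
Qed.

Lemma is_derive_proportionalV {R : realType} (f : R -> R) (a x : R) :
  f x != 0 -> is_derive x 1 f (a * f x) ->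
  is_derive x 1 (fun t => (f t)^-1) (- a * (f x)^-1).
Proof.
move=> f0 df; apply: is_derive_eq (is_deriveV f0 df) _.
by rewrite /GRing.scale/=; field.
Qed.

Lemma is_derive_cvg {R : realType} (f : R -> R) (x d : R) :
  is_derive x 1 f d ->
  (fun h : R => h^-1 *: (f (h *: (1 : R) + x) - f x)) @ 0^' --> d.
Proof.
move=> [/cvg_ex[l hl] e]; suff -> : d = l by [].
by rewrite -e; apply/cvg_lim.
Qed.

Lemma derive_gt0_right {R : realType} (f : R -> R) (x d : R) :
  is_derive x 1 f d -> 0 < d -> exists2 t : R, x < t & f x < f t.
Proof.
move=> df d0; have /cvgrPdist_lt/(_ _ d0) := is_derive_cvg df.
rewrite near_withinE => /nbhs_ballP[e /= e0 he].
have e2 : 0 < e / 2 by rewrite divr_gt0.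
exists (e / 2 + x); first by rewrite ltrDr.
have := he (e / 2); rewrite /ball/= sub0r normrN (gtr0_norm e2) gt_eqF//.
have h2 : e / 2 < e by lra.
move=> /(_ h2 isT); rewrite ltr_norml => /andP[_].
rewrite /GRing.scale/= mulr1 => h.
have : 0 < (e / 2)^-1 * (f (e / 2 + x) - f x) by lra.
by rewrite pmulr_rgt0 ?invr_gt0// subr_gt0.
Qed.

(* The change of variable [r = rad * e^(-2x)]; the factor 2 turns the barrier
   [r^(3/2)] into the natural power [expR (- x) ^+ 3]. *)
Definition radius {R : realType} (rad x : R) : R := rad * expR (- x) ^+ 2.

Lemma is_derive_expRN {R : realType} (x : R) :
  is_derive x 1 (fun t : R => expR (- t)) (-1 * expR (- x)).
Proof.
rewrite mulrC.
apply: (@is_derive1_comp _ expR (fun t : R => - t) x); exact: is_deriveNid.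
Qed.

Lemma radius_gt0 {R : realType} (rad x : R) : 0 < rad -> 0 < radius rad x.
Proof. by move=> r0; rewrite mulr_gt0// exprn_gt0// expR_gt0. Qed.

Lemma is_derive_radius {R : realType} (rad x : R) :
  is_derive x 1 (radius rad) (-2 * radius rad x).
Proof.
have d0 : is_derive x 1 (cst rad) (0 * cst rad x).
  by rewrite mul0r; exact: is_derive_cst.
apply: is_derive_eq (is_derive_proportionalM d0 (is_derive_proportionalX 2 (is_derive_expRN x))) _.
by rewrite /radius/=; ring.
Qed.

Lemma continuous_radius {R : realType} (rad : R) : continuous (radius rad).
Proof. by move=> x; exact: is_derive_continuous (is_derive_radius rad x). Qed.

Lemma continuous_radiusX {R : realType} (rad : R) n :
  continuous (fun x => radius rad x ^+ n).
Proof.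
move=> x; exact: is_derive_continuous (is_derive_proportionalX n (is_derive_radius rad x)).
Qed.

Lemma continuous_scaled_inv {R : realType} (c : R) (f : R -> R) :
  c != 0 -> (forall x, f x != 0) -> continuous f -> continuous (fun x => (c * f x)^-1).
Proof.
move=> c0 f0 cf x; apply: cvgV; first by rewrite mulf_neq0.
by apply: cvgM; [exact: cvg_cst|exact: cf].
Qed.

(** Both trapping properties are instances of [positive_propagation]: with [y - Y] and [z - Z] for
    the barrier, with [- y] and [- z] for the floor. *)
Lemma radial_solution {R : realType} (n : nat) (rad eps B : R) (L : R -> R) :
  (2 <= n)%N -> 0 < rad -> 0 < eps -> 0 <= B -> continuous L ->
  (forall x, 0 <= L x <= B) ->
  exists y z : R -> R, [/\ z 0 = - eps,
    forall x : R, 0 <= x -> is_derive x 1 y (2 * radius rad x ^+ n * z x),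
    forall x : R, 0 <= x -> is_derive x 1 z
      (2 * radius rad x ^+ 2 / (eps * radius rad x ^+ n) *
       (y x ^+ n / (n%:R * radius rad x ^+ (n * n.-1)) - L (radius rad x))) &
    exists M : R, forall x : R, 0 <= x -> 0 <= y x <= M * expR (- x) ^+ 3].
Proof.
move=> n2 rad0 eps0 B0 cL LB.
have n0 : (0 < n)%N by apply: leq_trans n2.
have rho0 x : 0 < radius rad x by exact: radius_gt0.
have rhon0 x k : 0 < radius rad x ^+ k by rewrite exprn_gt0.
pose a (x : R) : R := 2 * radius rad x ^+ n.
pose k (x : R) : R := 2 * radius rad x ^+ 2 / (eps * radius rad x ^+ n).
pose m (x : R) : R := (n%:R * radius rad x ^+ (n * n.-1))^-1.
pose l (x : R) : R := L (radius rad x).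
(* The first summand makes [Y] a supersolution against [L <= B]; the second makes [Z 0 < - eps], so
   that the solution starting at [M] rises above [Y]. *)
pose M : R := 2 * (rad ^+ 2 * B / eps + eps * rad ^+ n).
have radn0 : 0 < rad ^+ n by rewrite exprn_gt0.
have RB0 : 0 <= rad ^+ 2 * B / eps by rewrite divr_ge0 ?mulr_ge0 ?exprn_ge0// ltW.
have er0 : 0 < eps * rad ^+ n by rewrite mulr_gt0.
have M0 : 0 < M by rewrite /M; lra.
pose q t u := k t * (clamp M u ^+ n * m t - l t).
have ca : continuous a.
  apply: continuous_mul; [move=> x; exact: cvg_cst|exact: continuous_radiusX].
have ck : continuous k.
  apply: continuous_mul; first
    by apply: continuous_mul; [move=> x; exact: cvg_cst|exact: continuous_radiusX].
  by apply: continuous_scaled_inv;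
    [rewrite gt_eqF|move=> x; rewrite gt_eqF|exact: continuous_radiusX].
have cm : continuous m.
  by apply: continuous_scaled_inv;
    [rewrite pnatr_eq0 -lt0n|move=> x; rewrite gt_eqF|exact: continuous_radiusX].
have cl : continuous l.
  move=> x; apply: (@continuous_comp _ _ _ (radius rad) L); [exact: continuous_radius|exact: cL].
have qcl : continuous_lipschitz q by apply: continuous_lipschitz_clamp => //; exact: ltW.
have [y [z [yz0 dy dz lip]]] := second_order_flow (- eps) ca qcl.
have a0 (x : R) : 0 <= x -> 0 < a x by move=> _; rewrite mulr_gt0.
have k0 x : 0 < k x by rewrite divr_gt0// mulr_gt0.
have m0 x : 0 < m x by rewrite invr_gt0 mulr_gt0// ltr0n.
have r00 : radius rad 0 = rad by rewrite /radius oppr0 expR0 expr1n mulr1.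
(* [Y] is the barrier [M (r / rad)^(3/2)] and [Z] its [- Y_r / r^(n-1)]. *)
pose E3 (x : R) : R := expR (- x) ^+ 3.
have E30 x : 0 < E3 x by rewrite exprn_gt0// expR_gt0.
pose Y (x : R) : R := M * E3 x.
have Y0 x : 0 < Y x by rewrite mulr_gt0.
pose Z (x : R) : R := - (3 / 2) * M * (E3 x * (radius rad x ^+ n)^-1).
have dE3 (x : R) : is_derive x 1 E3 (3 * -1 * E3 x).
  exact: is_derive_proportionalX (is_derive_expRN x).
have dcst (c x : R) : is_derive x 1 (cst c) (0 * cst c x).
  by rewrite mul0r; exact: is_derive_cst.
have dY (x : R) : is_derive x 1 Y (a x * Z x).
  apply: is_derive_eq (is_derive_proportionalM (dcst M x) (dE3 x)) _.
  by rewrite /a /Z /=; field; rewrite gt_eqF.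
have dZ (x : R) : is_derive x 1 Z ((2 * n%:R - 3) * Z x).
  have h1 := is_derive_proportionalX n (is_derive_radius rad x).
  have h2 := @is_derive_proportionalV _ (fun t : R => radius rad t ^+ n) _ x
    (lt0r_neq0 (rhon0 x n)) h1.
  apply: is_derive_eq (is_derive_proportionalM (dcst (- (3 / 2) * M) x)
    (is_derive_proportionalM (dE3 x) h2)) _.
  by rewrite /Z /=; ring.
have n2R : 2 <= n%:R :> R by rewrite ler_nat.
have barrier c x1 x2 : c <= M -> 0 <= x1 -> x1 <= x2 ->
    0 < y c x1 - Y x1 -> 0 < y c x2 - Y x2.
  move=> cM x10 x12.
  apply: (@positive_propagation _ (fun x => y c x - Y x) a
    (fun x => z c x - Z x) (fun x => q x (y c x) - (2 * n%:R - 3) * Z x)) => //.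
  - move=> x x0; rewrite mulrBr; exact: is_deriveB (dy c x x0) (dY x).
  - move=> x x0; exact: is_deriveB (dz c x x0) (dZ x).
  (* Dropping the nonnegative power term leaves [q >= - k * B], while [- Z] has derivative
     [(2n - 3) * (3/2) * M * w] with [2n - 3 >= 1]. As [k * B] is [2 * (rad ^+ 2 * B / eps) * w]
     times [expR (- x) <= 1], the choice of [M] suffices. *)
  - move=> x x0 _.
    have E1 : expR (- x) <= 1 by rewrite -expR0 ler_expR oppr_le0.
    have Ep := expR_gt0 (- x).
    have q1 : - (k x * B) <= q x (y c x).
      rewrite /q -mulrN ler_pM2l//.
      have /andP[c0 _] := clamp_itv (y c x) (ltW M0).
      have : 0 <= clamp M (y c x) ^+ n * m x by rewrite mulr_ge0 ?exprn_ge0// ltW.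
      have /andP[_ lB] := LB (radius rad x); rewrite /l; lra.
    pose w := E3 x * (radius rad x ^+ n)^-1.
    have w0 : 0 < w by rewrite mulr_gt0// invr_gt0.
    have q2 : k x * B <= 2 * (rad ^+ 2 * B / eps) * w.
      have -> : k x * B = 2 * (rad ^+ 2 * B / eps) * w * expR (- x).
        rewrite /k /w /E3 {1}/radius; field.
        by rewrite !gt_eqF.
      by apply: ler_piMr => //; apply/mulr_ge0/ltW => //; exact: mulr_ge0.
    have -> : Z x = - (3 / 2 * M * w) by rewrite /Z /w; ring.
    have q3 : 3 / 2 * M * w <= (2 * n%:R - 3) * (3 / 2 * M * w).
      have Mw : 0 <= 3 / 2 * M * w by apply/mulr_ge0/ltW => //; lra.
      by apply: ler_peMl => //; lra.
    have q4 : 2 * (rad ^+ 2 * B / eps) * w <= 3 / 2 * M * w.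
      by rewrite ler_pM2r// /M; lra.
    by lra.
  - by have [-> _] := yz0 c; rewrite /Y /E3 oppr0 expR0 expr1n mulr1 subr_le0.
have floor c x1 x2 : 0 <= c -> 0 <= x1 -> x1 <= x2 -> 0 < - y c x1 -> 0 < - y c x2.
  move=> c0 x10 x12.
  apply: (@positive_propagation _ (fun x => - y c x) a
    (fun x => - z c x) (fun x => - q x (y c x))) => //.
  - move=> x x0; rewrite mulrN; exact: is_deriveN (dy c x x0).
  - move=> x x0; exact: is_deriveN (dz c x x0).
  (* Below 0 the clamped power is [0 ^+ n = 0], so only [- k * l <= 0] remains of [q]. *)
  - move=> x x0; rewrite oppr_gt0 => /ltW yx0.
    rewrite /q (clamp_le0 (ltW M0) yx0) expr0n eqn0Ngt n0/= mul0r sub0r mulrN opprK.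
    by apply: mulr_ge0; [exact: ltW|have /andP[] := LB (radius rad x)].
  - by have [-> _] := yz0 c; rewrite oppr_le0.
have start0 : exists2 x : R, 0 <= x & y 0 x < 0.
  have [] := @derive_gt0_right _ (fun x => - y 0 x) 0 (- (a 0 * z 0 0)).
  - exact: is_deriveN (dy 0 0 (lexx 0)).
  - by have [_ ->] := yz0 0; rewrite mulrN opprK mulr_gt0// a0.
  - move=> t t0; have [-> _] := yz0 0; rewrite oppr0 oppr_gt0 => yt.
    by exists t => //; exact: ltW.
have startM : exists2 x : R, 0 <= x & Y x < y M x.
  have [] := @derive_gt0_right _ (fun x => y M x - Y x) 0 (a 0 * z M 0 - a 0 * Z 0).
  - exact: is_deriveB (dy M 0 (lexx 0)) (dY 0).
  - have [_ ->] := yz0 M; rewrite -mulrBr mulr_gt0 ?a0//.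
    rewrite /Z /E3 oppr0 expR0 expr1n mul1r r00.
    have -> : - eps - - (3 / 2) * M / rad ^+ n = (3 / 2 * M - eps * rad ^+ n) / rad ^+ n.
      by field; rewrite gt_eqF.
    by rewrite divr_gt0// /M; lra.
  - move=> t t0; have [-> _] := yz0 M; rewrite {1}/Y /E3.
    rewrite oppr0 expR0 expr1n mulr1 subrr subr_gt0 => yt.
    by exists t => //; exact: ltW.
have [|c /andP[c0 cM] yY] := shooting M0 lip start0 startM.
  (* Whichever crossing comes first persists up to the other point, where [y] would be both negative
     and above [Y > 0]. *)
  move=> c x1 x2 /andP[c0 cM] x10 x20 y1 y2; have [x12|x21] := leP x1 x2.
    have := @floor c x1 x2 c0 x10 x12; rewrite !oppr_gt0 => /(_ y1) y2'.
    by have := Y0 x2; lra.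
  have := @barrier c x2 x1 cM x20 (ltW x21); rewrite !subr_gt0 => /(_ y2) y1'.
  by have := Y0 x1; lra.
exists (y c), (z c); split.
- by have [_ ->] := yz0 c.
- exact: dy.
- move=> x x0; have /andP[yx0 yx1] := yY x x0.
  have := dz c x x0; rewrite /q clamp_id// yx0 (le_trans yx1)// /Y.
  by rewrite ger_pMr// /E3 exprn_ile1 ?expR_ge0// -expR0 ler_expR oppr_le0.
- by exists M.
Qed.

(** * Return to the radial variable through the inverse of [radius] *)

Definition log_radius {R : realType} (rad r : R) : R := - (ln (r / rad) / 2).

Lemma expRN_log_radius {R : realType} (rad r : R) : 0 < rad -> 0 < r ->
  expR (- log_radius rad r) = Num.sqrt (r / rad).
Proof.
move=> rad0 r0; have h : 0 < r / rad by rewrite divr_gt0.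
rewrite -[LHS]ger0_norm ?expR_ge0// -sqrtr_sqr; congr Num.sqrt.
rewrite expr2 -expRD /log_radius opprK -splitr.
by rewrite lnK.
Qed.

Lemma radius_log_radius {R : realType} (rad r : R) : 0 < rad -> 0 < r ->
  radius rad (log_radius rad r) = r.
Proof.
move=> rad0 r0; rewrite /radius expRN_log_radius// sqr_sqrtr ?divr_ge0 ?ltW//.
by field; rewrite gt_eqF.
Qed.

Lemma log_radius_ge0 {R : realType} (rad r : R) : 0 < r -> r <= rad ->
  0 <= log_radius rad r.
Proof.
move=> r0 rr; have rad0 : 0 < rad by exact: lt_le_trans rr.
by rewrite oppr_ge0 pmulr_lle0 ?invr_gt0// ln_le0// ler_pdivrMr// mul1r.
Qed.

Lemma is_derive_log_radius {R : realType} (rad r : R) : 0 < rad -> 0 < r ->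
  is_derive r 1 (log_radius rad) (- (2 * r)^-1).
Proof.
move=> rad0 r0; have h : 0 < r / rad by rewrite divr_gt0.
have d1 : is_derive r 1 (fun t : R => t / rad) (rad^-1).
  apply: is_derive_eq (@is_deriveM _ _ id (cst rad^-1) r 1 _ _
    (is_derive_id _ _) (is_derive_cst _ _ _)) _.
  by rewrite /GRing.scale/= mulr0 add0r mulr1.
have d2 := @is_derive1_comp _ (@ln R) (fun t : R => t / rad) r _ _ (is_derive1_ln h) d1.
have d3 := @is_deriveN _ _ _ _ _ _ _
  (@is_deriveM _ _ _ (cst 2^-1) r 1 _ _ d2 (is_derive_cst _ _ _)).
apply: is_derive_eq d3 _.
by rewrite /GRing.scale/= mulr0 add0r; field; rewrite !gt_eqF.
Qed.

Lemma is_derive_cvg_left {R : realType} (f : R -> R) (x d : R) :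
  is_derive x 1 f d -> ((fun h => (f h - f x) / (h - x)) @ x^'- --> d).
Proof.
move=> /is_derive_cvg/cvgrPdist_lt H; apply/cvgrPdist_lt => e e0.
have := H _ e0; rewrite near_withinE => /nbhs_ballP[b /= b0 hb].
near=> t.
have tx : t < x by near: t; exact: nbhs_left_lt.
have bt : x - b < t by near: t; apply: nbhs_left_gt; rewrite ltrBlDr ltrDl.
have := hb (t - x); rewrite /ball/= sub0r normrN ltr0_norm ?subr_lt0// subr_eq0 lt_eqF//.
have -> : - (t - x) < b by lra.
by move=> /(_ isT isT); rewrite /GRing.scale/= mulr1 subrK mulrC.
Unshelve. all: by end_near. Qed.

Unset Implicit Arguments.

Theorem theorem3p5 (R : realType) (n : nat) (rad eps : R) (f : R -> R) :
  (2 <= n)%N -> 0 < rad -> 0 < eps ->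
  (@lebesgue_measure R).-integrable `]0, rad[ (fun t => (t ^+ n.-1 * f t)%:E) ->
  {ae @lebesgue_measure R, forall x, x \in `]0, rad[ -> 0 <= f x} ->
  ~ {ae @lebesgue_measure R, forall x, x \in `]0, rad[ -> f x = 0} ->
  exists w : R -> R,
    (* nonnegative on [0, R] *)
    (forall r, r \in `[0, rad] -> 0 <= w r) /\
    (* twice differentiable in (0, R) *)
    (forall r, r \in `]0, rad[ -> derivable w r 1 /\ derivable (derive1 w) r 1) /\
    (* the equation in (0, R) *)
    (forall r, r \in `]0, rad[ ->
       - eps * r ^+ n.-1 * derive1 (fun s => derive1 w s / s ^+ n.-1) r
       + w r ^+ n / (n%:R * r ^+ (n * n.-1)) = Lf n f r) /\
    (* boundary conditions: w(0) = 0, w_r(0) = 0 (right derivative),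
       w_r(R) = eps R^(n-1) (left derivative) *)
    w 0 = 0 /\
    ((fun h => (w h - w 0) / h) @ 0^'+ --> 0) /\
    ((fun h => (w h - w rad) / (h - rad)) @ rad^'- --> eps * rad ^+ n.-1).
Proof.
move=> n2 rad0 eps0 fi f0 _.
have [L [B B0 [cL LB LLf]]] := Lf_extension rad0 fi f0.
have [y [z [z0 dy dz [M yM]]]] := radial_solution n2 rad0 eps0 B0 cL LB.
have n0 : (0 < n)%N by apply: leq_trans n2.
pose x := log_radius rad.
have x0 r : 0 < r -> r <= rad -> 0 <= x r by exact: log_radius_ge0.
have xrad : x rad = 0 by rewrite /x /log_radius divff ?gt_eqF// ln1 mul0r oppr0.
have rx r : 0 < r -> radius rad (x r) = r by exact: radius_log_radius.
have dx (r : R) : 0 < r -> is_derive r 1 x (- (2 * r)^-1) by exact: is_derive_log_radius.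
(* The default 0 fixes [w 0]. At [rad] the point [x r] is 0, where [y] is two-sided differentiable,
   hence so is [w] at [rad]. *)
pose w r := if 0 < r then y (x r) else 0.
have w0 : w 0 = 0 by rewrite /w ltxx.
have wE r : 0 < r -> w r = y (x r) by rewrite /w => ->.
have dw (r : R) : 0 < r -> r <= rad -> is_derive r 1 w (- (r ^+ n.-1 * z (x r))).
  move=> r0 rr; apply: (@near_eq_is_derive _ _ _ (y \o x)).
    near=> t; have t0 : 0 < t by near: t; exact: lt_nbhsr.
    by rewrite /= wE.
  apply: is_derive_eq (is_derive1_comp (dy _ (x0 r r0 rr)) (dx r r0)) _.
  by rewrite rx// -[in LHS](prednK n0) exprS; field; rewrite gt_eqF.
have dw1 (r : R) : 0 < r -> r <= rad -> derive1 w r = - (r ^+ n.-1 * z (x r)).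
  by move=> r0 rr; have [_ <-] := dw r r0 rr; rewrite derive1E.
have dzx (r : R) : 0 < r -> r <= rad -> is_derive r 1 (fun t => - z (x t))
    (r / (eps * r ^+ n) * (w r ^+ n / (n%:R * r ^+ (n * n.-1)) - L r)).
  move=> r0 rr.
  have := is_deriveN (is_derive1_comp (dz _ (x0 r r0 rr)) (dx r r0)).
  move=> h; apply: is_derive_eq h _.
  rewrite rx// wE//; field.
  by rewrite !gt_eqF// ?exprn_gt0// ltr0n.
have near_r (r : R) : 0 < r -> r < rad ->
    \forall t \near r, derive1 w t = t ^+ n.-1 * - z (x t).
  move=> r0 rr; near=> t.
  have t0 : 0 < t by near: t; exact: lt_nbhsr.
  have tr : t < rad by near: t; exact: lt_nbhsl.
  by rewrite dw1 ?(ltW tr)// mulrN.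
exists w; split; [|split; [|split; [|split; [|split]]]] => //.
- move=> r; rewrite in_itv/= => /andP[r0 rr]; rewrite /w; case: ifPn => // r0'.
  by have /andP[] := yM _ (x0 r r0' rr).
- move=> r; rewrite in_itv/= => /andP[r0 rr]; split.
    by have [] := dw r r0 (ltW rr).
  apply: (@near_eq_derivable _ _ _ (fun t : R => t ^+ n.-1 * - z (x t))).
    by apply: filterS (near_r r r0 rr) => t ->.
  apply: derivableM; first exact: exprn_derivable.
  by have [] := dzx r r0 (ltW rr).
- move=> r; rewrite in_itv/= => /andP[r0 rr].
  (* Near [r] the inner quotient is [- z (x t)], so its derivative is given by the equation for
     [z]. *)
  have -> : derive1 (fun s => derive1 w s / s ^+ n.-1) r =
      r / (eps * r ^+ n) * (w r ^+ n / (n%:R * r ^+ (n * n.-1)) - L r).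
    rewrite derive1E (@near_eq_derive _ _ _ _ (fun t : R => - z (x t))).
      by have [_ ->] := dzx r r0 (ltW rr).
    near=> t; have t0 : 0 < t by near: t; exact: lt_nbhsr.
    have -> : derive1 w t = t ^+ n.-1 * - z (x t) by near: t; exact: near_r.
    by rewrite mulrC mulKf// expf_neq0// gt_eqF.
  rewrite -LLf ?r0// -[X in r / (_ * r ^+ X)](prednK n0) exprS; field.
  by rewrite !gt_eqF// ?exprn_gt0// ltr0n.
(* The barrier divided by [h]: [M * (h / rad)^(3/2) / h = M / rad * Num.sqrt (h / rad)], which
   squeezes the difference quotient to 0. *)
- have hs : (fun h : R => M / rad * Num.sqrt (h / rad)) @ 0^'+ --> M / rad * 0.
    apply: cvgM; first exact: cvg_cst.
    apply: cvg_at_right_filter.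
    rewrite -[X in _ --> X](_ : Num.sqrt (0 / rad) = 0); last by rewrite mul0r sqrtr0.
    apply: (@continuous_comp _ _ _ (fun h : R => h / rad) Num.sqrt); last exact: sqrt_continuous.
    by apply: cvgM; [exact: cvg_id|exact: cvg_cst].
  rewrite mulr0 in hs.
  apply: (@squeeze_cvgr _ _ _ _ (cst 0) _ _ _ _ _ hs); last exact: cvg_cst.
  near=> h.
  have h0 : 0 < h by near: h; exact: nbhs_right_gt.
  have hr : h <= rad by near: h; exact: nbhs_right_le.
  have /andP[y0 y1] := yM _ (x0 h h0 hr).
  rewrite w0 subr0 wE// divr_ge0 ?(ltW h0)//=.
  rewrite ler_pdivrMr//; apply: le_trans y1 _.
  rewrite expRN_log_radius// exprSr sqr_sqrtr; last by rewrite divr_ge0 ?ltW.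
  by rewrite le_eqVlt; apply/orP; left; apply/eqP; field; rewrite gt_eqF.
- apply: is_derive_cvg_left.
  apply: is_derive_eq (dw rad rad0 (lexx _)) _.
  by rewrite xrad z0; ring.
Unshelve. all: by end_near. Qed.
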